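(* Let $\mathcal{D}$ be a distribution on $\mathbb{R}^d\times\mathbb{R}$ such that, for $(\mathbf{x},y)\sim\mathcal{D}$, $\|\mathbf{x}\|_\infty\le1$ and $|y|\le B$ with probability $1$, and suppose the second moments $\mathbb{E}_{\mathcal{D}}[x_i^2]$, $i\in[d]$, are known. Let $\bar{\mathbf{w}}$ be the output of DDAELR on $m$ i.i.d. examples with budget $k$, run with $\eta=\frac{1}{2B}\sqrt{\frac{\log 2d}{5m\left(\frac1k\|\mathbb{E}_{\mathcal{D}}[\mathbf{x}^2]\|_1+1\right)}}$. If $m\ge\log 2d$, then for every $\mathbf{w}^*\in\mathbb{R}^d$ with $\|\mathbf{w}^*\|_1\le B$, $$\mathbb{E}_{\mathcal{D},A}\big[L_{\mathcal{D}}(\bar{\mathbf{w}})\big]\le L_{\mathcal{D}}(\mathbf{w}^* )+4B^2\sqrt{\frac{5\log 2d\left(\frac1k\|\mathbb{E}_{\mathcal{D}}[\mathbf{x}^2]\|_1+1\right)}{m}}.$$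
   Context: Loss $\ell(\mathbf{w};\mathbf{x},y)=\frac12(\langle\mathbf{w},\mathbf{x}\rangle-y)^2$; risk $L_{\mathcal{D}}(\mathbf{w})=\mathbb{E}_{(\mathbf{x},y)\sim\mathcal{D}}[\ell]$. $\mathbb{E}_{\mathcal{D}}[\mathbf{x}^2]$ is the vector of second moments $\mathbb{E}_{\mathcal{D}}[x_i^2]$. $\mathrm{clip}(x,c)=\max\{\min\{x,c\},-c\}$. Algorithm GAELR (parameters $B,\eta>0$, probabilities $q_i$ summing to $1$, budget $k$; examples $(\mathbf{x}_t,y_t)$, $t=1..m$): $\mathbf{z}_1^\pm=\mathbf{1}_d$. For each $t$: $\mathbf{w}_t=(\mathbf{z}_t^+-\mathbf{z}_t^-)B/(\|\mathbf{z}_t^+\|_1+\|\mathbf{z}_t^-\|_1)$; for $r=1..k$ draw $i_{t,r}$ with probability $q_{i_{t,r}}$, $\widetilde{\mathbf{x}}_{t,r}=\frac{1}{q_{i_{t,r}}}\mathbf{x}_t[i_{t,r}]\mathbf{e}_{i_{t,r}}$; $\widetilde{\mathbf{x}}_t=\frac1k\sum_r\widetilde{\mathbf{x}}_{t,r}$; draw $j_t$ with probability $p_j=|w_{t,j}|/\|\mathbf{w}_t\|_1$, $\widetilde\phi_t=\frac{w_{t,j_t}}{p_{j_t}}\mathbf{x}_t[j_t]-y_t$; $\widetilde{\mathbf{g}}_t=\widetilde\phi_t\widetilde{\mathbf{x}}_t$; $\bar{\mathbf{g}}_t[i]=\mathrm{clip}(\widetilde{\mathbf{g}}_t[i],1/\eta)$;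 $\mathbf{z}_{t+1}^+[i]=\mathbf{z}_t^+[i]e^{-\eta\bar{\mathbf{g}}_t[i]}$, $\mathbf{z}_{t+1}^-[i]=\mathbf{z}_t^-[i]e^{\eta\bar{\mathbf{g}}_t[i]}$. Output $\frac1m\sum_t\mathbf{w}_t$. DDAELR is GAELR with $q_i=\mathbb{E}_{\mathcal{D}}[x_i^2]/\sum_{j=1}^d\mathbb{E}_{\mathcal{D}}[x_j^2]$. $\mathbb{E}_{\mathcal{D},A}$ is expectation over examples and algorithm randomness. *)

(* Defs.v *)
From HB Require Import structures.
From mathcomp Require Import all_boot all_order all_algebra.
From mathcomp Require Import all_classical all_reals all_analysis.
Set Implicit Arguments. Unset Strict Implicit. Unset Printing Implicit Defensive.
Import Order.TTheory GRing.Theory Num.Theory.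
Import numFieldNormedType.Exports.
Local Open Scope classical_set_scope.
Local Open Scope ring_scope.

(* The distribution D on R^d x R is represented as the joint law of
   (x, y) = ((X i)_i, Y) on a probability space (T, P). *)

Section GAELR.
Context {R : realType} {dsp : measure_display} {T : measurableType dsp}.
Variable P : probability T R.
Variable d : nat.
Variable X : 'I_d -> T -> R.
Variable Y : T -> R.

Definition clip (x c : R) : R := Num.max (Num.min x c) (- c).

Definition inner (w x : 'I_d -> R) : R := \sum_i w i * x i.

Definition norm1 (w : 'I_d -> R) : R := \sum_i `|w i|.

Definition sqloss (w x : 'I_d -> R) (y : R) : R := 2^-1 * (inner w x - y) ^+ 2.

Definition risk (w : 'I_d -> R) : R :=
  Rintegral P setT (fun om => sqloss w (fun i => X i om) (Y om)).

Definition second_moment (i : 'I_d) : R :=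
  Rintegral P setT (fun om => X i om ^+ 2).

Definition gaelr_w (B : R) (zp zn : 'I_d -> R) : 'I_d -> R :=
  fun i => (zp i - zn i) * B / (norm1 zp + norm1 zn).

(* Expectation over the draw of j_t ~ p_j = |w_j| / ||w||_1 of F(phi~_t).
   When w = 0 (e.g. at t = 1) the estimate w_j/p_j x[j] of <w,x> is taken
   to be 0, i.e. phi~ = -y. *)
Definition draw_j (w x : 'I_d -> R) (y : R) (F : R -> R) : R :=
  if norm1 w == 0 then F (- y)
  else \sum_j (`|w j| / norm1 w) * F (w j / (`|w j| / norm1 w) * x j - y).

Definition xtilde (q : 'I_d -> R) (k : nat) (s : {ffun 'I_k -> 'I_d})
  (x : 'I_d -> R) : 'I_d -> R :=
  fun i => k%:R^-1 * \sum_(r < k | s r == i) x i / q i.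

(* gaelr_exp B eta q k m n zp zn acc : the expectation (over the remaining
   n i.i.d. examples from D and the algorithm's internal randomness) of
   L_D(acc_final / m), when the current state is (z^+, z^-) = (zp, zn),
   and acc is the sum of the iterates w_t produced so far. *)
Fixpoint gaelr_exp (B eta : R) (q : 'I_d -> R) (k m : nat) (n : nat)
  (zp zn acc : 'I_d -> R) {struct n} : R :=
  match n with
  | 0 => risk (fun i => acc i / m%:R)
  | n'.+1 =>
    Rintegral P setT (fun om =>
      let x := fun i => X i om in
      let y := Y om in
      let w := gaelr_w B zp zn in
      \sum_(s : {ffun 'I_k -> 'I_d}) (\prod_(r < k) q (s r)) *
        draw_j w x y (fun phi =>
          let g := fun i => clip (phi * xtilde q s x i) eta^-1 in
          gaelr_exp B eta q k m n'
            (fun i => zp i * expR (- (eta * g i)))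
            (fun i => zn i * expR (eta * g i))
            (fun i => acc i + w i)))
  end.

Definition gaelr_expected_risk (B eta : R) (q : 'I_d -> R) (k m : nat) : R :=
  gaelr_exp B eta q k m m (fun _ => 1) (fun _ => 1) (fun _ => 0).

Definition ddaelr_q : 'I_d -> R :=
  fun i => second_moment i / \sum_j second_moment j.

Definition ddaelr_expected_risk (B eta : R) (k m : nat) : R :=
  gaelr_expected_risk B eta ddaelr_q k m.

End GAELR.

(* Main.v *)
Require Import Defs.
From HB Require Import structures.
From mathcomp Require Import all_boot all_order all_algebra.
From mathcomp Require Import all_classical all_reals all_analysis.
From mathcomp Require Import measurable_realfun ring lra.
Import Order.TTheory GRing.Theory Num.Theory.
Import numFieldNormedType.Exports.
Import HBNNSimple.
Local Open Scope classical_set_scope.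
Local Open Scope ring_scope.

(** Along the run z^+ = exp(-theta) and z^- = exp(theta) coordinatewise, so the state is a
    vector theta and one round is theta := theta + eta * gbar.  For a comparator u the potential
    (B ln W(theta) + <u, theta>) / eta, with W(theta) = sum_i (exp(-theta_i) + exp(theta_i)), is
    nonnegative since |theta_i| <= ln W(theta), and starts at B ln(2d) / eta.  By
    exp v <= 1 + v + 2 v^2 for |v| <= 1, a round decreases it by <w - u, gbar> up to a term
    quadratic in gbar; clipping costs |clip(g, 1/eta) - g| <= eta g^2, again quadratic.
    The gradient estimate is unbiased and |phi| <= 2B, so the quadratic terms cost at most
    4 B eta * 4 B^2 (S/k + 1) per round in expectation, while the linear term is at least the
    excess loss of w over u.  The induction on the number of remaining rounds bounds the nested
    integrals by an explicit integrable function of the current example, so that the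
    measurability of the iterated expectation in the state is never needed. *)

(** * Elementary inequalities for the exponential and for clipping *)

(** For [|v| <= 1/2] the bound follows from [exp v <= 1 / (1 - v)], because [(1 + v + 2 v^2) (1 - v)
    = 1 + v^2 (1 - 2 v)]. Squaring it at [v = u / 2] reaches [|u| <= 1], with the slack
    [u^2 (1 - u) (3 + u) / 4]. *)
Lemma expR_le_quad {R : realType} (u : R) : `|u| <= 1 -> expR u <= 1 + u + 2 * u ^+ 2.
Proof.
move=> u1.
have half (v : R) : `|v| <= 2^-1 -> expR v <= 1 + v + 2 * v ^+ 2.
  rewrite ler_norml => /andP[v1 v2].
  have h := expR_ge1Dx (- v); rewrite expRN in h.
  have ep := expR_gt0 v.
  have h' : expR v * (1 - v) <= 1.
    by rewrite -ler_pdivlMl// mulr1.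
  rewrite -(@ler_pM2r _ (1 - v)); last by lra.
  apply: (le_trans h'); nra.
have h2 : expR u = expR (u / 2) ^+ 2 by rewrite -expRM_natl; congr expR; field.
have : expR (u / 2) <= 1 + u / 2 + 2 * (u / 2) ^+ 2.
  by apply: half; rewrite normrM (@ger0_norm _ 2^-1)//; lra.
have := expR_gt0 (u / 2); rewrite h2; set e := expR _ => e0 h.
move: u1; rewrite ler_norml => /andP[u1 u2].
have h3 : e ^+ 2 <= (1 + u / 2 + 2 * (u / 2) ^+ 2) ^+ 2.
  by rewrite ler_sqr ?nnegrE ?(ltW e0)//; apply: le_trans h; exact: ltW.
apply: (le_trans h3); rewrite -subr_ge0.
have -> : 1 + u + 2 * u ^+ 2 - (1 + u / 2 + 2 * (u / 2) ^+ 2) ^+ 2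
  = u ^+ 2 * ((1 - u) * (3 + u)) / 4 by field.
by rewrite divr_ge0// mulr_ge0 ?sqr_ge0// mulr_ge0//; lra.
Qed.

Lemma clip_norm_le {R : realType} (x c : R) : 0 <= c -> `|clip x c| <= c.
Proof.
move=> c0; rewrite /clip ler_norml; case: (leP x c) => ?;
  [case: (leP x (- c))|case: (leP c (- c))] => *; apply/andP; split; lra.
Qed.

Lemma clip_norm_le_id {R : realType} (x c : R) : 0 <= c -> `|clip x c| <= `|x|.
Proof.
move=> c0; rewrite /clip ler_norml; case: (leP x c) => ?;
  [case: (leP x (- c))|case: (leP c (- c))] => ?; case: (ger0P x) => *;
  apply/andP; split; lra.
Qed.

(** The distance is zero when [|x| <= c]; otherwise it is [|x| - c], at most [|x|], and
    [|x| <= x^2 / c]. *)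
Lemma clip_dist_le {R : realType} (x c : R) : 0 < c -> `|clip x c - x| <= c^-1 * x ^+ 2.
Proof.
move=> c0; rewrite ler_pdivlMl// -{1}(gtr0_norm c0) -normrM /clip ler_norml.
case: (leP x c) => ?; [case: (leP x (- c))|case: (leP c (- c))] => ?;
  apply/andP; split.
all: nra.
Qed.

(** * Integration: comparison, finite sums, vanishing squares *)

(* The left-hand integrand need not be measurable: the integral of a nonnegative
   function is the supremum of the integrals of the simple functions below it. *)
Lemma le_Rintegral_lower {R : realType} {dsp : measure_display}
    {T : measurableType dsp} (P : {measure set T -> \bar R}) (f h : T -> R) :
  (forall x, 0 <= f x) -> P.-integrable setT (EFin \o h) ->
  {ae P, forall x, f x <= h x} ->
  Rintegral P setT f <= Rintegral P setT h.
Proof.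
move=> f0 hi fh.
have mh := measurable_int _ hi.
have hfin : (\int[P]_x (h x)%:E)%E \is a fin_num by exact: integrable_fin_num hi.
have le : (\int[P]_x (f x)%:E <= \int[P]_x (h x)%:E)%E.
  (* [h] is nonnegative only almost everywhere, so it is replaced by its absolute value before
     integrals of nonnegative functions are compared. *)
  rewrite (_ : \int[P]_x (h x)%:E = \int[P]_x `|(h x)%:E|)%E; last first.
    apply: ae_eq_integral => //.
      by apply/measurable_EFinP; apply: measurableT_comp => //; exact/measurable_EFinP.
    apply: filterS fh => x fh _ /=; rewrite ger0_norm//.
    exact: le_trans fh.
  rewrite ge0_integralTE; last by move=> x; rewrite lee_fin.
  apply: ge_ereal_sup => _ [s sf <-].
  rewrite -integralT_nnsfun.
  apply: ae_ge0_le_integral => //.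
  - by move=> x _; rewrite lee_fin.
  - exact/measurable_EFinP.
  - by apply/measurable_EFinP; apply: measurableT_comp => //; exact/measurable_EFinP.
  - apply: filterS fh => x fh _ /=; rewrite lee_fin.
    apply: le_trans (ler_norm _); apply: le_trans fh.
    by have := sf x; rewrite lee_fin.
rewrite /Rintegral fine_le//.
rewrite ge0_fin_numE; last by apply: integral_ge0 => x _; rewrite lee_fin.
by apply: le_lt_trans le _; rewrite ltey_eq hfin.
Qed.

Lemma ae_bounded_integrable {R : realType} {dsp : measure_display}
    {T : measurableType dsp} (P : probability T R) (f : T -> R) (C : R) :
  measurable_fun setT f -> {ae P, forall x, `|f x| <= C} ->
  P.-integrable setT (EFin \o f).
Proof.
move=> mf fC; apply/integrableP; split; first exact/measurable_EFinP.
apply: (@le_lt_trans _ _ (\int[P]_x (cst `|C|%:E) x)%E).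
  apply: ae_ge0_le_integral => //.
  - by do 2 apply: measurableT_comp => //; exact/measurable_EFinP.
  - by move=> x _ /=; rewrite lee_fin.
  - apply: filterS fC => x fC _ /=; rewrite lee_fin.
    by apply: le_trans fC (ler_norm _).
by rewrite integral_cst// lte_mul_pinfty// (le_lt_trans (probability_le1 P measurableT))// ltry.
Qed.

Lemma integrable_sumR {R : realType} {dsp : measure_display}
    {T : measurableType dsp} (P : {measure set T -> \bar R}) (I : Type) (s : seq I)
    (f : I -> T -> R) :
  (forall i, P.-integrable setT (EFin \o f i)) ->
  P.-integrable setT (EFin \o (fun x => \sum_(i <- s) f i x)).
Proof.
move=> fi; have := @integrable_sum _ _ _ P _ measurableT _ s xpredT _ (fun i _ => fi i).
by apply: eq_integrable => // x _ /=; rewrite sumEFin.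
Qed.

Lemma integrableZR {R : realType} {dsp : measure_display}
    {T : measurableType dsp} (P : {measure set T -> \bar R}) (c : R) (f : T -> R) :
  P.-integrable setT (EFin \o f) ->
  P.-integrable setT (EFin \o (fun x => c * f x)).
Proof. exact: integrableZl. Qed.

Lemma Rintegral_sum {R : realType} {dsp : measure_display}
    {T : measurableType dsp} (P : {measure set T -> \bar R}) (I : Type) (s : seq I)
    (f : I -> T -> R) :
  (forall i, P.-integrable setT (EFin \o f i)) ->
  Rintegral P setT (fun x => \sum_(i <- s) f i x) = \sum_(i <- s) Rintegral P setT (f i).
Proof.
move=> fi; elim: s => [|i s ih].
  by under eq_Rintegral do rewrite big_nil; rewrite big_nil Rintegral_cst// mul0r.
under eq_Rintegral do rewrite big_cons.
by rewrite big_cons RintegralD// ?ih//; exact: integrable_sumR.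
Qed.

(** A coordinate that is never sampled has zero second moment under DDAELR, so it vanishes almost
    surely and its zero estimate is still unbiased. *)
Lemma Rintegral_sqr_eq0 {R : realType} {dsp : measure_display}
    {T : measurableType dsp} (P : {measure set T -> \bar R}) (f : T -> R) :
  measurable_fun setT f -> P.-integrable setT (EFin \o (fun x => f x ^+ 2)) ->
  Rintegral P setT (fun x => f x ^+ 2) = 0 -> {ae P, forall x, f x = 0}.
Proof.
move=> mf fi f0.
have mf2 := measurable_int _ fi.
have : (\int[P]_x `|(f x ^+ 2)%:E|)%E = 0.
  under eq_integral do rewrite gee0_abs ?lee_fin ?sqr_ge0//.
  rewrite -[LHS]fineK; first exact: (congr1 EFin f0).
  exact: (integrable_fin_num _ fi).
move/(ae_eq_integral_abs P measurableT mf2); apply: filterS => x /(_ I) /= [].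
by move/eqP; rewrite sqrf_eq0 => /eqP.
Qed.

(** * Moments of the sampled example and of the sampled residual *)

(** The [k] draws are independent, and each draw outside [A] contributes the factor
    [\sum_i q i = 1]. Empty, singleton and two-element [A] give the total mass, the mean and the
    mixed second moments. *)
Lemma expect_prod_ffun {R : realType} {d k : nat} (q h : 'I_d -> R) (A : {set 'I_k}) :
  \sum_i q i = 1 ->
  \sum_(s : {ffun 'I_k -> 'I_d}) (\prod_(r < k) q (s r)) * (\prod_(r in A) h (s r))
  = (\sum_i q i * h i) ^+ #|A|.
Proof.
move=> q1.
transitivity (\sum_(s : {ffun 'I_k -> 'I_d})
    \prod_(r < k) (q (s r) * (if r \in A then h (s r) else 1))).
  by apply: eq_bigr => s _; rewrite big_split/= -big_mkcond.
rewrite -(bigA_distr_bigA (fun r i => q i * (if r \in A then h i else 1))).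
rewrite -prodr_const [RHS]big_mkcond; apply: eq_bigr => r _.
by case: ifP => // _; under eq_bigr do rewrite mulr1.
Qed.

Lemma xtildeE {R : realType} {d k : nat} (q : 'I_d -> R) (s : {ffun 'I_k -> 'I_d})
    (x : 'I_d -> R) (i : 'I_d) :
  xtilde q s x i = k%:R^-1 * (x i / q i) * \sum_(r < k) (s r == i)%:R.
Proof.
rewrite /xtilde big_mkcond/= -mulrA; congr (_ * _); rewrite mulr_sumr.
by apply: eq_bigr => r _; case: eqP => _; rewrite ?mulr1 ?mulr0.
Qed.

Lemma sum_indic {R : realType} {d : nat} (q : 'I_d -> R) (i : 'I_d) :
  \sum_j q j * (j == i)%:R = q i.
Proof.
rewrite (bigD1 i)//= eqxx mulr1 big1 ?addr0// => j /negPf ->; exact: mulr0.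
Qed.

Lemma xtilde_mean {R : realType} {d k : nat} (q : 'I_d -> R) (x : 'I_d -> R) (i : 'I_d) :
  (0 < k)%N -> \sum_j q j = 1 -> (q i = 0 -> x i = 0) ->
  \sum_(s : {ffun 'I_k -> 'I_d}) (\prod_(r < k) q (s r)) * xtilde q s x i = x i.
Proof.
move=> k0 q1 qx.
have kn0 : k%:R != 0 :> R by rewrite pnatr_eq0 -lt0n.
under eq_bigr do rewrite xtildeE mulrCA mulr_sumr.
rewrite -mulr_sumr exchange_big/=.
rewrite (eq_bigr (fun _ => q i)); last first.
  move=> r _; have := @expect_prod_ffun R d k q (fun j => (j == i)%:R) [set r] q1.
  by rewrite cards1 expr1 sum_indic => <-; apply: eq_bigr => s _; rewrite big_set1.
rewrite sumr_const card_ord -mulr_natl.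
(* With [q i = 0] the estimate is zero by the convention [0^-1 = 0], and so is [x i]. *)
have [q0|qn0] := eqVneq (q i) 0; first by rewrite qx // !mul0r mulr0 mul0r.
by field; rewrite qn0 kn0.
Qed.

(** Up to the factor [x i / (k q i)], the estimate counts the draws equal to [i]. In the second
    moment of this count every pair of draws contributes at most [q i ^ 2], plus [q i] on the
    diagonal, whence [k q i + k^2 q i ^ 2]. *)
Lemma xtilde_sqr_mean {R : realType} {d k : nat} (q : 'I_d -> R) (x : 'I_d -> R) (i : 'I_d) :
  (0 < k)%N -> (forall j, 0 <= q j) -> \sum_j q j = 1 ->
  \sum_(s : {ffun 'I_k -> 'I_d}) (\prod_(r < k) q (s r)) * xtilde q s x i ^+ 2
  <= ((k%:R * q i)^-1 + 1) * x i ^+ 2.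
Proof.
move=> k0 q0 q1.
have kgt0 : 0 < k%:R :> R by rewrite ltr0n.
under eq_bigr do rewrite xtildeE exprMn mulrCA.
rewrite -mulr_sumr.
have [qi0|qn0] := eqVneq (q i) 0.
  by rewrite qi0 invr0 !mulr0 expr0n mul0r invr0 add0r mul1r sqr_ge0.
have qi : 0 < q i by rewrite lt_def qn0 q0.
have pair r0 r1 : \sum_(s : {ffun 'I_k -> 'I_d})
    (\prod_(r < k) q (s r)) * ((s r0 == i)%:R * (s r1 == i)%:R)
    <= (r0 == r1)%:R * q i + q i ^+ 2.
  have := @expect_prod_ffun R d k q (fun j => (j == i)%:R) [set r0; r1] q1.
  rewrite cards2 sum_indic; have [<-|ne] := eqVneq r0 r1.
    rewrite finset.setUid expr1 mul1r => h.
    apply: (@le_trans _ _ (q i)); last by rewrite lerDl sqr_ge0.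
    rewrite -h; apply: ler_sum => s _; rewrite big_set1.
    by case: eqP => _; rewrite ?mulr1 ?mulr0.
  rewrite mul0r add0r => <-; apply: ler_sum => s _.
  by rewrite big_setU1 ?inE//= big_set1.
have sq : \sum_(s : {ffun 'I_k -> 'I_d})
    (\prod_(r < k) q (s r)) * (\sum_(r < k) (s r == i)%:R) ^+ 2
    <= k%:R * q i + k%:R ^+ 2 * q i ^+ 2.
  rewrite (eq_bigr (fun s : {ffun 'I_k -> 'I_d} => \sum_(r0 < k) \sum_(r1 < k)
      (\prod_(r < k) q (s r)) * ((s r0 == i)%:R * (s r1 == i)%:R))); last first.
    move=> s _; rewrite expr2 big_distrlr/= mulr_sumr.
    by apply: eq_bigr => r0 _; rewrite mulr_sumr.
  rewrite exchange_big/=; under eq_bigr do rewrite exchange_big/=.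
  apply: (@le_trans _ _ (\sum_(r0 < k) \sum_(r1 < k) ((r0 == r1)%:R * q i + q i ^+ 2))).
    by apply: ler_sum => r0 _; apply: ler_sum => r1 _; exact: pair.
  rewrite le_eqVlt; apply/orP; left; apply/eqP.
  under eq_bigr => r0 _.
    rewrite big_split/= -mulr_suml sumr_const card_ord.
    rewrite (bigD1 r0)//= eqxx big1 ?addr0; last first.
      by move=> r1; rewrite eq_sym => /negPf ->.
    rewrite mul1r.
    over.
  by rewrite sumr_const card_ord -[LHS]mulr_natl -[q i ^+ 2 *+ k]mulr_natl; ring.
apply: le_trans (ler_wpM2l (sqr_ge0 _) sq) _.
rewrite le_eqVlt; apply/orP; left; apply/eqP.
by field; rewrite qn0 lt0r_neq0.
Qed.

Lemma draw_j_ge0 {R : realType} {d : nat} (w x : 'I_d -> R) (y : R) (F : R -> R) :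
  (forall phi, 0 <= F phi) -> 0 <= draw_j w x y F.
Proof.
move=> F0; rewrite /draw_j; case: ifP => // _.
by apply: sumr_ge0 => j _; rewrite mulr_ge0// divr_ge0// sumr_ge0.
Qed.

(** An affine bound on [F] passes through the expectation because the residual has mean
    [inner w x - y]. The bound is needed only for [|phi| <= 2 * B], the range of the residuals that
    occur. *)
Lemma draw_j_le_affine {R : realType} {d : nat} (B : R) (w x : 'I_d -> R) (y : R)
    (F : R -> R) (a b : R) :
  norm1 w <= B -> (forall i, `|x i| <= 1) -> `|y| <= B ->
  (forall phi, `|phi| <= 2 * B -> F phi <= a + b * phi) ->
  draw_j w x y F <= a + b * (inner w x - y).
Proof.
move=> wB x1 yB Fle.
have w0 : 0 <= norm1 w by exact: sumr_ge0.
rewrite /draw_j; case: eqP => [n0|/eqP n0].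
  have wi0 i : w i = 0.
    by apply/normr0_eq0/(psumr_eq0P _ n0).
  rewrite (_ : inner w x = 0) ?sub0r; last by apply: big1 => i _; rewrite wi0 mul0r.
  by apply: Fle; rewrite normrN; lra.
have n_gt0 : 0 < norm1 w by rewrite lt_def n0.
have p1 : \sum_j `|w j| / norm1 w = 1 by rewrite -mulr_suml divff.
apply: (@le_trans _ _ (\sum_j `|w j| / norm1 w *
    (a + b * (w j / (`|w j| / norm1 w) * x j - y)))).
  apply: ler_sum => j _; apply: ler_wpM2l; first by rewrite divr_ge0.
  apply: Fle; apply: (le_trans (ler_normB _ _)).
  (* The importance ratio has absolute value [norm1 w], or zero when [w j = 0]. *)
  have : `|w j / (`|w j| / norm1 w) * x j| <= norm1 w.
    rewrite invf_div normrM -[leRHS]mulr1 ler_pM// mulrCA normrM (gtr0_norm n_gt0).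
    rewrite -[leRHS]mulr1 ler_wpM2l// normrM normfV normr_id.
    by have [->|wn0] := eqVneq (w j) 0; rewrite ?normr0 ?mul0r// divff// normr_eq0.
  lra.
rewrite le_eqVlt; apply/orP; left; apply/eqP.
transitivity (\sum_j (a * (`|w j| / norm1 w) + b * (w j * x j) - b * y * (`|w j| / norm1 w))).
  apply: eq_bigr => j _.
  have [->|wn0] := eqVneq (w j) 0; first by rewrite normr0 !mul0r; ring.
  by field; rewrite n0 normr_eq0.
rewrite sumrB big_split/= -!mulr_sumr p1 /inner; ring.
Qed.

(** * The potential and its change in one round *)

Definition mass {R : realType} {d : nat} (th : 'I_d -> R) : R :=
  \sum_i (expR (- th i) + expR (th i)).

Definition share {R : realType} {d : nat} (th : 'I_d -> R) (i : 'I_d) : R :=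
  (expR (- th i) + expR (th i)) / mass th.

(* All iterates satisfy z^+ z^- = 1 coordinatewise, so the state is [(expR (- th), expR th)]. *)
Definition iterate {R : realType} {d : nat} (B : R) (th : 'I_d -> R) : 'I_d -> R :=
  gaelr_w B (fun i => expR (- th i)) (fun i => expR (th i)).

Definition potential {R : realType} {d : nat} (B eta : R) (u th : 'I_d -> R) : R :=
  eta^-1 * (B * ln (mass th) + inner u th).

Lemma norm1_ge0 {R : realType} {d : nat} (w : 'I_d -> R) : 0 <= norm1 w.
Proof. exact: sumr_ge0. Qed.

Lemma mass_gt0 {R : realType} {d : nat} (th : 'I_d -> R) : (0 < d)%N -> 0 < mass th.
Proof.
case: d th => // d th _; rewrite /mass big_ord_recl ltr_wpDr ?addr_gt0 ?expR_gt0//.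
by apply: sumr_ge0 => i _; rewrite addr_ge0 ?expR_ge0.
Qed.

Lemma share_ge0 {R : realType} {d : nat} (th : 'I_d -> R) (i : 'I_d) : 0 <= share th i.
Proof.
by rewrite divr_ge0 ?sumr_ge0// => *; rewrite addr_ge0 ?expR_ge0.
Qed.

Lemma sum_share {R : realType} {d : nat} (th : 'I_d -> R) :
  (0 < d)%N -> \sum_i share th i = 1.
Proof. by move=> d0; rewrite -mulr_suml divff// gt_eqF// mass_gt0. Qed.

Lemma iterateE {R : realType} {d : nat} (B : R) (th : 'I_d -> R) (i : 'I_d) :
  iterate B th i = (expR (- th i) - expR (th i)) * B / mass th.
Proof.
rewrite /iterate /gaelr_w /norm1 /mass big_split/=.
by congr (_ / (_ + _)); apply: eq_bigr => j _; rewrite ger0_norm ?expR_ge0.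
Qed.

Lemma norm1_iterate {R : realType} {d : nat} (B : R) (th : 'I_d -> R) :
  0 < B -> (0 < d)%N -> norm1 (iterate B th) <= B.
Proof.
move=> B0 d0; have m0 := mass_gt0 th d0.
apply: (@le_trans _ _ (\sum_i B * share th i)); last by rewrite -mulr_sumr sum_share ?mulr1.
apply: ler_sum => i _; rewrite iterateE /share mulrA !normrM normfV (gtr0_norm m0) (gtr0_norm B0).
rewrite ler_wpM2r ?invr_ge0 ?(ltW m0)// mulrC ler_wpM2l ?(ltW B0)//.
by apply: le_trans (ler_normB _ _) _; rewrite !gtr0_norm ?expR_gt0.
Qed.

Lemma potential_ge0 {R : realType} {d : nat} (B eta : R) (u th : 'I_d -> R) :
  (0 < d)%N -> 0 < eta -> norm1 u <= B -> 0 <= potential B eta u th.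
Proof.
move=> d0 eta0 uB; have m0 := mass_gt0 th d0.
have thm i : `|th i| <= ln (mass th).
  have mi : expR (- th i) + expR (th i) <= mass th.
    by rewrite /mass (bigD1 i)//= lerDl sumr_ge0// => j _; rewrite addr_ge0 ?expR_ge0.
  have e1 := expR_gt0 (th i); have e2 := expR_gt0 (- th i).
  rewrite -ler_expR lnK ?posrE//; case: (ger0P (th i)) => _; lra.
have ln0 : 0 <= ln (mass th).
  case: d d0 u th uB m0 thm => // d _ u th _ _ thm.
  exact: le_trans (thm ord0).
rewrite mulr_ge0 ?invr_ge0 ?(ltW eta0)//.
(* Hölder's inequality, with [ln (mass th)] bounding the sup norm of [th]. *)
have : - inner u th <= norm1 u * ln (mass th).
  rewrite /inner /norm1 -sumrN mulr_suml; apply: ler_sum => i _.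
  apply: le_trans (ler_norm _) _; rewrite normrN normrM.
  by rewrite ler_wpM2l.
have := ler_wpM2r ln0 uB; lra.
Qed.

Lemma potential0 {R : realType} {d : nat} (B eta : R) (u : 'I_d -> R) :
  potential B eta u (fun=> 0) = eta^-1 * (B * ln (2 * d%:R)).
Proof.
congr (_ * _); rewrite [inner _ _]big1 ?addr0; last by move=> i _; rewrite mulr0.
by rewrite /mass /= oppr0 expR0 sumr_const card_ord mulr_natr.
Qed.

(** The logarithm is linearised by [ln (1 + r) <= r] at the relative growth of the mass, which
    [expR_le_quad] bounds to second order. Divided by the mass, the first-order term is the iterate
    and the second-order weight is [share]; the term in [u] changes exactly linearly. *)
Lemma potential_step {R : realType} {d : nat} (B eta : R) (u th g : 'I_d -> R) :
  (0 < d)%N -> 0 < B -> 0 < eta -> (forall i, `|eta * g i| <= 1) ->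
  potential B eta u (fun i => th i + eta * g i)
  <= potential B eta u th
     + \sum_i ((u i - iterate B th i) * g i + 2 * B * eta * share th i * g i ^+ 2).
Proof.
move=> d0 B0 eta0 g1; have m0 := mass_gt0 th d0.
set th' := fun i => _; have m'0 := mass_gt0 th' d0.
have lnle : ln (mass th') <= ln (mass th) + (mass th' / mass th - 1).
  have r0 : 0 < mass th' / mass th by rewrite divr_gt0.
  have E : mass th' = mass th * (1 + (mass th' / mass th - 1)).
    by field; rewrite gt_eqF.
  rewrite {1}E lnM ?posrE//; last by rewrite addrC subrK.
  by rewrite lerD2l; apply: le_ln1Dx; lra.
have mle : mass th' <= mass th + \sum_i (- (expR (- th i) - expR (th i)) * (eta * g i)
    + 2 * (expR (- th i) + expR (th i)) * (eta * g i) ^+ 2).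
  rewrite /mass -big_split/=; apply: ler_sum => i _.
  rewrite /th' opprD !expRD.
  have e1 : expR (- (eta * g i)) <= 1 - eta * g i + 2 * (eta * g i) ^+ 2.
    by have := @expR_le_quad R (- (eta * g i)); rewrite normrN sqrrN; apply.
  have e2 := expR_le_quad _ (g1 i).
  have := ler_wpM2l (expR_ge0 (- th i)) e1; have := ler_wpM2l (expR_ge0 (th i)) e2.
  by lra.
have -> : potential B eta u th' = eta^-1 * (B * ln (mass th') + inner u th) + inner u g.
  have -> : inner u g = eta^-1 * (eta * inner u g) by rewrite mulKf ?gt_eqF.
  rewrite /potential -mulrDr -addrA; congr (_ * (_ + _)).
  rewrite /inner mulr_sumr -big_split; apply: eq_bigr => i _; rewrite /th'/=; ring.
rewrite /potential.
have step : eta^-1 * (B * ln (mass th')) <= eta^-1 * (B * ln (mass th)) +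
    eta^-1 * B * (mass th' / mass th - 1).
  rewrite -mulrA -mulrDr ler_wpM2l ?invr_ge0 ?(ltW eta0)//.
  by rewrite -mulrDr ler_wpM2l ?(ltW B0).
have step2 : eta^-1 * B * (mass th' / mass th - 1) <=
    \sum_i (- iterate B th i * g i + 2 * B * eta * share th i * g i ^+ 2).
  apply: (@le_trans _ _ (eta^-1 * B * ((\sum_i (- (expR (- th i) - expR (th i)) * (eta * g i)
    + 2 * (expR (- th i) + expR (th i)) * (eta * g i) ^+ 2)) / mass th))).
    rewrite ler_wpM2l ?mulr_ge0 ?invr_ge0 ?(ltW eta0) ?(ltW B0)//.
    by rewrite lerBlDr ler_pdivrMr// mulrDl divfK ?gt_eqF// mul1r addrC.
  rewrite le_eqVlt; apply/orP; left; apply/eqP.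
  rewrite mulr_suml mulr_sumr; apply: eq_bigr => i _; rewrite iterateE /share.
  by field; rewrite !gt_eqF.
have -> : \sum_i ((u i - iterate B th i) * g i + 2 * B * eta * share th i * g i ^+ 2)
  = inner u g + \sum_i (- iterate B th i * g i + 2 * B * eta * share th i * g i ^+ 2).
  by rewrite /inner -big_split; apply: eq_bigr => i _ /=; ring.
lra.
Qed.

(** Coefficient of the squared unclipped gradient: the first summand pays for clipping in the linear
    term, the second for the quadratic term of the exponential. *)
Definition round_weight {R : realType} {d : nat} (B eta : R) (u th : 'I_d -> R) (i : 'I_d) : R :=
  eta * (`|iterate B th i - u i| + 2 * B * share th i).

Lemma round_weight_ge0 {R : realType} {d : nat} (B eta : R) (u th : 'I_d -> R) (i : 'I_d) :
  0 < B -> 0 < eta -> 0 <= round_weight B eta u th i.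
Proof.
by move=> B0 eta0; rewrite mulr_ge0 ?(ltW eta0)// addr_ge0// mulr_ge0 ?share_ge0//; lra.
Qed.

(** The iterate and the comparator contribute [B] each, and the shares, which sum to one, contribute
    [2 * B]. *)
Lemma sum_round_weight {R : realType} {d : nat} (B eta : R) (u th : 'I_d -> R) :
  (0 < d)%N -> 0 < B -> 0 < eta -> norm1 u <= B ->
  \sum_i round_weight B eta u th i <= 4 * B * eta.
Proof.
move=> d0 B0 eta0 uB; rewrite -mulr_sumr mulrC ler_wpM2r ?(ltW eta0)//.
rewrite big_split/= -mulr_sumr sum_share// mulr1.
have : \sum_i `|iterate B th i - u i| <= norm1 (iterate B th) + norm1 u.
  by rewrite /norm1 -big_split; apply: ler_sum => i _; exact: ler_normB.
have := norm1_iterate B th B0 d0; lra.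
Qed.

(** Clipping at [eta^-1] makes [potential_step] applicable. Returning to the raw gradient costs
    [eta * g i ^ 2] per unit of [w i - u i] in the linear term, and clipping only shrinks the
    quadratic one. *)
Lemma potential_clip_step {R : realType} {d : nat} (B eta : R) (u th g : 'I_d -> R) :
  (0 < d)%N -> 0 < B -> 0 < eta ->
  potential B eta u (fun i => th i + eta * clip (g i) eta^-1)
  <= potential B eta u th
     + \sum_i ((u i - iterate B th i) * g i + round_weight B eta u th i * g i ^+ 2).
Proof.
move=> d0 B0 eta0; have ei0 : 0 < eta^-1 by rewrite invr_gt0.
apply: le_trans (@potential_step R d B eta u th (fun i => clip (g i) eta^-1) d0 B0 eta0 _) _ => [i|].
  rewrite normrM gtr0_norm// -ler_pdivlMl// mulr1.
  exact/clip_norm_le/ltW.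
rewrite lerD2l; apply: ler_sum => i _.
have h1 : (u i - iterate B th i) * (clip (g i) eta^-1 - g i)
    <= `|iterate B th i - u i| * (eta * g i ^+ 2).
  apply: le_trans (ler_norm _) _; rewrite normrM distrC ler_wpM2l//.
  by have := clip_dist_le (g i) _ ei0; rewrite invrK.
have h2 : clip (g i) eta^-1 ^+ 2 <= g i ^+ 2.
  by rewrite -[leLHS]real_normK ?num_real// -[leRHS]real_normK ?num_real//
    ler_sqr ?nnegrE// clip_norm_le_id ?ltW.
have c0 : 0 <= 2 * B * eta * share th i.
  by rewrite mulr_ge0 ?share_ge0// mulr_ge0 ?(ltW eta0)// mulr_ge0 ?(ltW B0).
have := ler_wpM2l c0 h2; rewrite /round_weight; lra.
Qed.

(** * One round in expectation over the internal randomness *)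

Lemma Rintegral_probability_cst {R : realType} {dsp : measure_display}
    {T : measurableType dsp} (P : probability T R) (c : R) :
  Rintegral P setT (fun=> c) = c.
Proof.
rewrite Rintegral_cst//.
have := @probability_setT _ _ _ P => /= ->; exact: mulr1.
Qed.

Lemma sqloss_ge0 {R : realType} {d : nat} (w x : 'I_d -> R) (y : R) : 0 <= sqloss w x y.
Proof. by rewrite mulr_ge0 ?sqr_ge0// invr_ge0. Qed.

(** Convexity of the loss: for predictions [a] and [b] the gap is [n (a - b)^2 / (2 (n + 1))]. It
    lets the induction add one iterate at a time to the running average. *)
Lemma sqloss_average {R : realType} {d : nat} (n : nat) (v w x : 'I_d -> R) (y : R) :
  n.+1%:R * sqloss (fun i => (n%:R * v i + w i) / n.+1%:R) x y
  <= n%:R * sqloss v x y + sqloss w x y.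
Proof.
have n0 : 0 < n.+1%:R :> R by rewrite ltr0n.
rewrite /sqloss (_ : inner _ x = (n%:R * inner v x + inner w x) / n.+1%:R); last first.
  rewrite /inner mulr_sumr -big_split/= mulr_suml.
  by apply: eq_bigr => i _; field; rewrite gt_eqF.
set a := inner v x; set b := inner w x.
rewrite -subr_ge0 (_ : _ - _ = 2^-1 * (n%:R * (a - b) ^+ 2) / n.+1%:R); last first.
  by move: n0; rewrite -natr1 => n0; field; rewrite gt_eqF.
by rewrite divr_ge0 ?(ltW n0)// mulr_ge0 ?invr_ge0// mulr_ge0 ?sqr_ge0.
Qed.

(** [F s phi] stands for the expected final risk after the round. The example is fixed here, so the
    bound is pointwise and can serve as the integrand of an upper bound. *)
Lemma expected_round {R : realType} {d k : nat} (B eta A c : R) (q u x th : 'I_d -> R)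
    (y : R) (F : {ffun 'I_k -> 'I_d} -> R -> R) :
  (0 < d)%N -> (0 < k)%N -> 0 < B -> 0 < eta -> 0 <= c ->
  (forall j, 0 <= q j) -> \sum_j q j = 1 -> (forall i, q i = 0 -> x i = 0) ->
  (forall i, `|x i| <= 1) -> `|y| <= B ->
  (forall s phi, F s phi <= A + c * potential B eta u
     (fun i => th i + eta * clip (phi * xtilde q s x i) eta^-1)) ->
  \sum_(s : {ffun 'I_k -> 'I_d}) (\prod_(r < k) q (s r)) * draw_j (iterate B th) x y (F s)
  <= A + c * potential B eta u th + c * (sqloss u x y - sqloss (iterate B th) x y
     + \sum_i 4 * B ^+ 2 * round_weight B eta u th i * ((k%:R * q i)^-1 + 1) * x i ^+ 2).
Proof.
move=> d0 k0 B0 eta0 c0 q0 q1 qx x1 yB Fle.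
set w := iterate B th; set v := inner w x - y.
set rw := round_weight B eta u th.
have rw0 i : 0 <= rw i by exact: round_weight_ge0.
have p0 (s : {ffun 'I_k -> 'I_d}) : 0 <= \prod_(r < k) q (s r) by exact: prodr_ge0.
have p1 : \sum_(s : {ffun 'I_k -> 'I_d}) \prod_(r < k) q (s r) = 1.
  have := @expect_prod_ffun R d k q (fun=> 1) finset.set0 q1.
  by rewrite cards0 expr0 => h; rewrite -[RHS]h; apply: eq_bigr => s _; rewrite big_set0 mulr1.
(* For fixed [s], replacing [phi ^+ 2] by [4 * B ^+ 2] leaves an expression affine in [phi];
   averaging over [j] then turns [phi] into [v]. The average over [s] is taken afterwards. *)
apply: (@le_trans _ _ (\sum_(s : {ffun 'I_k -> 'I_d}) (\prod_(r < k) q (s r)) *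
   ((A + c * potential B eta u th) +
    c * \sum_i (4 * B ^+ 2 * rw i * xtilde q s x i ^+ 2 + v * (u i - w i) * xtilde q s x i)))).
  apply: ler_sum => s _; apply: ler_wpM2l => //.
  apply: le_trans (@draw_j_le_affine _ _ B w x y (F s)
    (A + c * potential B eta u th + c * \sum_i 4 * B ^+ 2 * rw i * xtilde q s x i ^+ 2)
    (c * \sum_i (u i - w i) * xtilde q s x i) _ x1 yB _) _.
  - exact: norm1_iterate.
  - move=> phi phiB; apply: le_trans (Fle s phi) _.
    have phi2 : phi ^+ 2 <= 4 * B ^+ 2.
      by rewrite -real_normK ?num_real// (_ : 4 * B ^+ 2 = (2 * B) ^+ 2) ?ler_sqr ?nnegrE//;
        [lra|ring].
    have := @potential_clip_step R d B eta u th (fun i => phi * xtilde q s x i) d0 B0 eta0.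
    rewrite -/w -/rw big_split/=.
    have -> : \sum_i (u i - w i) * (phi * xtilde q s x i)
      = (\sum_i (u i - w i) * xtilde q s x i) * phi.
      by rewrite mulr_suml; apply: eq_bigr => i _; ring.
    have : \sum_i rw i * (phi * xtilde q s x i) ^+ 2 <=
      \sum_i 4 * B ^+ 2 * rw i * xtilde q s x i ^+ 2.
      apply: ler_sum => i _.
      rewrite exprMn mulrCA -[leRHS]mulrA.
      by apply: ler_wpM2r phi2; rewrite mulr_ge0 ?sqr_ge0.
    move=> h1 h2; have := ler_wpM2l c0 (le_trans h2 (lerD (lexx _) (lerD (lexx _) h1))).
    by rewrite !mulrDr; lra.
  - rewrite -/v; clearbody v; rewrite le_eqVlt; apply/orP; left; apply/eqP.
    rewrite big_split/= mulrDr addrA; congr (_ + _).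
    rewrite -[LHS]mulrA mulr_suml; congr (_ * _).
    by apply: eq_bigr => i _; ring.
under eq_bigr do rewrite mulrDr.
rewrite big_split/= -mulr_suml p1 mul1r lerD2l.
under eq_bigr do rewrite mulrCA mulr_sumr.
rewrite -mulr_sumr ler_wpM2l// exchange_big/=.
apply: (@le_trans _ _ (\sum_i (4 * B ^+ 2 * rw i * ((k%:R * q i)^-1 + 1) * x i ^+ 2
    + v * (u i - w i) * x i))).
  apply: ler_sum => i _.
  under eq_bigr do rewrite mulrDr.
  rewrite big_split/=; apply: lerD.
    under eq_bigr do rewrite mulrCA.
    rewrite -mulr_sumr -[leRHS]mulrA ler_wpM2l//; last exact: xtilde_sqr_mean.
    by apply: mulr_ge0 (rw0 i); rewrite mulr_ge0 ?sqr_ge0.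
  under eq_bigr do rewrite mulrCA.
  by rewrite -mulr_sumr xtilde_mean //; exact: qx.
rewrite big_split/= addrC lerD2r.
have -> : \sum_i v * (u i - w i) * x i = v * (inner u x - inner w x).
  by rewrite /inner -sumrB mulr_sumr; apply: eq_bigr => i _; ring.
(* Convexity again: [(b - y) (a - b)] is the loss difference minus [(a - b)^2 / 2]. *)
rewrite /v /sqloss; set a := inner u x; set b := inner w x.
have := sqr_ge0 (a - b); lra.
Qed.

(** * Induction over the remaining rounds *)

Lemma gaelr_exp_ge0 {R : realType} {dsp : measure_display} {T : measurableType dsp}
    (P : probability T R) {d : nat} (X : 'I_d -> T -> R) (Y : T -> R) (B eta : R)
    (q : 'I_d -> R) (k m n : nat) (zp zn acc : 'I_d -> R) :
  (forall j, 0 <= q j) -> 0 <= gaelr_exp P X Y B eta q k m n zp zn acc.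
Proof.
move=> q0; elim: n zp zn acc => [|n IH] zp zn acc /=.
  by apply: Rintegral_ge0 => om _; exact: sqloss_ge0.
apply: Rintegral_ge0 => om _; apply: sumr_ge0 => s _.
by rewrite mulr_ge0 ?prodr_ge0//; apply: draw_j_ge0.
Qed.

Lemma sqloss_integrable {R : realType} {dsp : measure_display} {T : measurableType dsp}
    (P : probability T R) {d : nat} (X : 'I_d -> T -> R) (Y : T -> R) (B : R) (w : 'I_d -> R) :
  (forall i, measurable_fun setT (X i)) -> measurable_fun setT Y ->
  {ae P, forall om, (forall i, `|X i om| <= 1) /\ `|Y om| <= B} ->
  P.-integrable setT (EFin \o (fun om => sqloss w (fun i => X i om) (Y om))).
Proof.
move=> mX mY good.
apply: (@ae_bounded_integrable _ _ _ P _ (2^-1 * (norm1 w + B) ^+ 2)).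
  apply: measurable_funM => //; apply: measurable_funX; apply: measurable_funB => //.
  by apply: measurable_sum => i; apply: measurable_funM.
apply: filterS good => om [X1 YB].
rewrite ger0_norm ?sqloss_ge0// ler_wpM2l ?invr_ge0//.
rewrite -real_normK ?num_real// lerXn2r ?nnegrE// ?addr_ge0 ?norm1_ge0//.
  exact: le_trans YB.
apply: le_trans (ler_normB _ _) _; apply: lerD => //.
apply: le_trans (ler_norm_sum _ _ _) _; apply: ler_sum => i _.
by rewrite normrM ler_piMr.
Qed.

(** After [j] rounds [v] is the average of the past iterates and [A] bounds their total risk; each
    of the [n] rounds to come is charged [risk u + K]. [K] is uniform in the state, so the claim can
    hold for every [th] and be applied under the integral. *)
Lemma gaelr_exp_le {R : realType} {dsp : measure_display} {T : measurableType dsp}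
    (P : probability T R) {d : nat} (X : 'I_d -> T -> R) (Y : T -> R) (B eta K : R)
    (q u : 'I_d -> R) (k m : nat) :
  (0 < d)%N -> (0 < k)%N -> (0 < m)%N -> 0 < B -> 0 < eta ->
  (forall j, 0 <= q j) -> \sum_j q j = 1 -> norm1 u <= B ->
  (forall i, measurable_fun setT (X i)) -> measurable_fun setT Y ->
  {ae P, forall om, (forall i, `|X i om| <= 1) /\ `|Y om| <= B} ->
  (forall i, q i = 0 -> {ae P, forall om, X i om = 0}) ->
  (forall th, \sum_i 4 * B ^+ 2 * round_weight B eta u th i * ((k%:R * q i)^-1 + 1)
     * second_moment P X i <= K) ->
  forall n j (th v zp zn acc : 'I_d -> R) (A : R), (j + n = m)%N ->
  (forall i, zp i = expR (- th i)) -> (forall i, zn i = expR (th i)) ->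
  (forall i, acc i = j%:R * v i) -> j%:R * risk P X Y v <= A ->
  gaelr_exp P X Y B eta q k m n zp zn acc
  <= m%:R^-1 * (A + n%:R * (risk P X Y u + K)) + m%:R^-1 * potential B eta u th.
Proof.
move=> d0 k0 m0 B0 eta0 q0 q1 uB mX mY good qX HK.
have m0r : 0 < m%:R :> R by rewrite ltr0n.
have mi0 : 0 <= m%:R^-1 :> R by rewrite invr_ge0 ltW.
have iL w := sqloss_integrable P X Y B w mX mY good.
have iX2 i : P.-integrable setT (EFin \o (fun om => X i om ^+ 2)).
  apply: (@ae_bounded_integrable _ _ _ P _ 1); first exact: measurable_funX.
  by apply: filterS good => om [X1 _]; rewrite normrX exprn_ile1.
have nul : {ae P, forall om, forall i, q i = 0 -> X i om = 0}.
  apply: filter_forall => i; have [qi|qi] := eqVneq (q i) 0.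
    by apply: filterS (qX i qi).
  by apply: nearW => om /eqP; rewrite (negPf qi).
elim=> [|n IH] j th v zp zn acc A jn zpE znE accE vA.
  rewrite mul0r addr0 -mulrDr.
  (* No rounds remain: the potential is dropped, being nonnegative. *)
  have pot0 := potential_ge0 B eta u th d0 eta0 uB.
  rewrite /= -ler_pdivrMl ?invr_gt0// invrK.
  apply: (@le_trans _ _ A); last by rewrite lerDl.
  apply: le_trans vA; rewrite -jn addn0 (_ : (fun i => acc i / j%:R) = v)//.
  by apply: funext => i; rewrite accE mulrC mulKf// gt_eqF// -[j]addn0 jn.
have -> : zp = (fun i => expR (- th i)) by exact: funext.
have -> : zn = (fun i => expR (th i)) by exact: funext.
rewrite /= -/(iterate B th).
set w := iterate B th.
(* The current iterate joins the average, so its risk is added to [A]; integrating [- L w] in [h]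
   cancels it and leaves the risk of [u]. *)
set C := m%:R^-1 * (A + risk P X Y w + n%:R * (risk P X Y u + K)).
set e := fun i => 4 * B ^+ 2 * round_weight B eta u th i * ((k%:R * q i)^-1 + 1).
set L := fun w om => sqloss w (fun i => X i om) (Y om).
set h := fun om => (C + m%:R^-1 * potential B eta u th) +
  m%:R^-1 * (L u om - L w om + \sum_i e i * X i om ^+ 2).
have iS : P.-integrable setT (EFin \o (fun om => \sum_i e i * X i om ^+ 2)).
  by apply: integrable_sumR => i; exact: integrableZR.
have iD : P.-integrable setT (EFin \o (fun om => L u om - L w om)).
  exact: (@integrableB _ _ _ P _ measurableT _ _ (iL u) (iL w)).
have iDS : P.-integrable setT (EFin \o (fun om => L u om - L w om + \sum_i e i * X i om ^+ 2)).
  exact: (@integrableD _ _ _ P _ measurableT _ _ iD iS).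
have iC (c : R) : P.-integrable setT (EFin \o (fun=> c)).
  by apply: (@ae_bounded_integrable _ _ _ P _ `|c|) => //; exact: nearW.
have ih : P.-integrable setT (EFin \o h).
  exact: (@integrableD _ _ _ P _ measurableT _ _ (iC _) (integrableZR _ _ _ iDS)).
apply: (@le_trans _ _ (Rintegral P setT h)); last first.
  rewrite RintegralD//; last exact: integrableZR.
  rewrite RintegralZl// RintegralD// RintegralB; [|by []|exact: iL|exact: iL].
  rewrite [X in X + _ <= _](Rintegral_probability_cst P).
  rewrite Rintegral_sum; last by move=> i; exact: integrableZR.
  under eq_bigr do rewrite RintegralZl//.
  have HKth : \sum_i e i * Rintegral P setT (fun om => X i om ^+ 2) <= K := HK th.
  have := ler_wpM2l mi0 HKth.
  rewrite /C -/(risk P X Y u) -/(risk P X Y w) -[n.+1%:R]natr1; lra.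
(* Only nonnegativity is asked of the nested expectation; integrability is asked of [h]. *)
apply: le_Rintegral_lower => //.
  move=> om; apply: sumr_ge0 => s _; rewrite mulr_ge0 ?prodr_ge0//.
  by apply: draw_j_ge0 => phi; exact: gaelr_exp_ge0.
have jS : 0 < j.+1%:R :> R by rewrite ltr0n.
have vA' : j.+1%:R * risk P X Y (fun i => (j%:R * v i + w i) / j.+1%:R) <= A + risk P X Y w.
  apply: le_trans (lerD vA (lexx _)).
  rewrite /risk -!RintegralZl// -RintegralD//; last exact: integrableZR.
  apply: le_Rintegral => //; first exact: integrableZR.
    exact: (@integrableD _ _ _ P _ measurableT _ _ (integrableZR _ _ _ (iL v)) (iL w)).
  by move=> om _; exact: sqloss_average.
apply: filterS2 good nul => om [X1 YB] X0.
apply: expected_round => // s phi.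
apply: IH vA' => [|i|i|i].
- by rewrite addSnnS.
- by rewrite opprD expRD.
- by rewrite expRD.
- by rewrite accE [RHS]mulrC divfK// gt_eqF.
Qed.

(** * The DDAELR probabilities and the tuned step size *)

Theorem theorem6 (R : realType) (dsp : measure_display) (T : measurableType dsp)
  (P : probability T R) (d : nat) (X : 'I_d -> T -> R) (Y : T -> R)
  (B : R) (m k : nat) :
  0 < B ->
  (0 < k)%N ->
  (forall i, measurable_fun setT (X i)) ->
  measurable_fun setT Y ->
  {ae P, forall om, (forall i, `|X i om| <= 1) /\ `|Y om| <= B} ->
  0 < \sum_i second_moment P X i ->
  ln (2 * d%:R : R) <= m%:R ->
  let S := norm1 (second_moment P X) in
  let eta := (2 * B)^-1 *
     Num.sqrt (ln (2 * d%:R : R) / (5 * m%:R * (k%:R^-1 * S + 1))) in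
  forall wstar : 'I_d -> R, norm1 wstar <= B ->
  ddaelr_expected_risk P X Y B eta k m
    <= risk P X Y wstar
       + 4 * B ^+ 2 * Num.sqrt (5 * ln (2 * d%:R : R) * (k%:R^-1 * S + 1) / m%:R).
Proof.
move=> B0 k0 mX mY good S0 lnm S eta u uB.
have d0 : (0 < d)%N by case: d X mX good S0 {S eta u uB lnm} => // ? ? ?; rewrite big_ord0 ltxx.
have kr0 : 0 < k%:R :> R by rewrite ltr0n.
set l := ln (2 * d%:R : R) in lnm eta *.
have l0 : 0 < l.
  by apply: ln_gt0; have : 1 <= d%:R :> R by [rewrite ler1n]; lra.
have m0r : 0 < m%:R :> R by exact: lt_le_trans lnm.
have m0 : (0 < m)%N by rewrite -(@ltr0n R).
have s0 i : 0 <= second_moment P X i by apply: Rintegral_ge0 => om _; exact: sqr_ge0.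
have s1 i : second_moment P X i <= 1.
  rewrite -[leRHS](Rintegral_probability_cst P); apply: le_Rintegral_lower => [om||].
  - exact: sqr_ge0.
  - by apply: (@ae_bounded_integrable _ _ _ P _ 1) => //; apply: nearW => om; rewrite normr1.
  - by apply: filterS good => om [X1 _]; rewrite -real_normK ?num_real// exprn_ile1.
have iX2 i : P.-integrable setT (EFin \o (fun om => X i om ^+ 2)).
  apply: (@ae_bounded_integrable _ _ _ P _ 1); first exact: measurable_funX.
  by apply: filterS good => om [X1 _]; rewrite normrX exprn_ile1.
have SE : S = \sum_i second_moment P X i.
  by apply: eq_bigr => i _; rewrite ger0_norm.
have S_gt0 : 0 < S by rewrite SE.
set M := k%:R^-1 * S + 1.
have M0 : 0 < M by rewrite ltr_wpDl// mulr_ge0 ?invr_ge0 ?(ltW kr0) ?(ltW S_gt0).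
set r := Num.sqrt (l / (5 * m%:R * M)).
have lm0 : 0 < l / (5 * m%:R * M) by rewrite divr_gt0// !mulr_gt0.
have r0 : 0 < r by rewrite sqrtr_gt0.
have r2 : r ^+ 2 = l / (5 * m%:R * M) by rewrite sqr_sqrtr// ltW.
(* Expressing [l] and [eta] through [r] removes the square roots from the final computation. *)
have lE : l = 5 * m%:R * M * r ^+ 2 by rewrite r2; field; rewrite !gt_eqF.
have etaE : eta = (2 * B)^-1 * r by [].
have eta0 : 0 < eta by rewrite etaE mulr_gt0// invr_gt0; lra.
set q := ddaelr_q P X.
have qE i : q i = second_moment P X i / S by rewrite SE.
have q0 i : 0 <= q i by rewrite qE divr_ge0 ?(ltW S_gt0).
have q1 : \sum_i q i = 1.
  by under eq_bigr do rewrite qE; rewrite -mulr_suml -SE divff// gt_eqF.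
have qX i : q i = 0 -> {ae P, forall om, X i om = 0}.
  move/eqP; rewrite qE mulf_eq0 invr_eq0 (gt_eqF S_gt0) orbF => /eqP si.
  exact: Rintegral_sqr_eq0 si.
(* The choice of [q] cancels the second moment [s i]: [(1 / (k q i) + 1) * s i] equals [S / k + s i]
   when [s i] is nonzero and is zero otherwise, so it is at most [M]. The factor [4 * B * eta] is
   the total round weight. *)
have HK th : \sum_i 4 * B ^+ 2 * round_weight B eta u th i * ((k%:R * q i)^-1 + 1)
     * second_moment P X i <= 4 * B ^+ 2 * M * (4 * B * eta).
  apply: le_trans (ler_wpM2l _ (sum_round_weight B eta u th d0 B0 eta0 uB)); last first.
    by apply: mulr_ge0 (ltW M0); rewrite mulr_ge0 ?sqr_ge0.
  rewrite mulr_sumr; apply: ler_sum => i _.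
  rewrite -mulrA [leRHS]mulrAC; apply: ler_wpM2l.
    by apply: mulr_ge0; rewrite ?round_weight_ge0// mulr_ge0 ?sqr_ge0.
  rewrite mulrDl mul1r (lerD _ (s1 i))// qE.
  have [->|sn0] := eqVneq (second_moment P X i) 0.
    by rewrite mulr0 mulr_ge0 ?invr_ge0 ?(ltW kr0) ?(ltW S_gt0).
  rewrite le_eqVlt; apply/orP; left; apply/eqP.
  by field; rewrite sn0 !gt_eqF.
have H := @gaelr_exp_le R dsp T P d X Y B eta _ q u k m d0 k0 m0 B0 eta0 q0 q1 uB mX mY
  good qX HK m 0 (fun=> 0) (fun=> 0) (fun=> 1) (fun=> 1) (fun=> 0) 0 (add0n m).
rewrite /ddaelr_expected_risk /gaelr_expected_risk -/q.
apply: le_trans (H _ _ _ _) _; rewrite ?oppr0 ?expR0 ?mul0r// {H}.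
rewrite potential0 -/l.
have -> : Num.sqrt (5 * l * M / m%:R) = 5 * M * r.
  have -> : 5 * l * M / m%:R = (5 * M * r) ^+ 2.
    by rewrite lE; field; rewrite gt_eqF.
  rewrite sqrtr_sqr ger0_norm//.
  exact: mulr_ge0 (mulr_ge0 (ler0n _ _) (ltW M0)) (ltW r0).
(* With [eta = r / (2 B)], the quadratic cost gives [8 * B^2 * M * r] and the initial potential
   [10 * B^2 * M * r]; the target allows [20]. *)
have -> : m%:R^-1 * (0 + m%:R * (risk P X Y u + 4 * B ^+ 2 * M * (4 * B * eta))) +
   m%:R^-1 * (eta^-1 * (B * l)) = risk P X Y u + 18 * (B ^+ 2 * M * r).
  by rewrite etaE {1}lE; field; rewrite !gt_eqF.
have : 0 <= B ^+ 2 * M * r.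
  exact: mulr_ge0 (mulr_ge0 (sqr_ge0 B) (ltW M0)) (ltW r0).
lra.
Qed.
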